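(* Let $n\in\mathbb{N}$ and let $\zeta_n$ be a primitive $n$-th root of unity. For all $l,s\in\mathbb{Z}_{\geq 0}$, the sum $$W_n^3(l,s)=\sum_{\substack{d_0+d_1+\cdots+d_s=l\\ d_0,\ldots,d_s\geq 0}}z_n\left(\{3\}^{d_0},4,\{3\}^{d_1},4,\ldots,4,\{3\}^{d_s};\zeta_n\right)$$ (in which the entry $4$ occurs exactly $s$ times) satisfies $$W_n^3(l,s)=\frac{(-1)^s}{n^3(s+1)}\binom{s+l}{l}\left[\binom{n+3s+2l+2}{4s+3l+3}+(-1)^l\binom{n+s+l}{4s+3l+3}+A(n,l,s)\right](1-\zeta_n)^{4s+3l},$$ where $$A(n,l,s)=\sum_{i=1}^{s+l+1}\frac{-(s+1)}{i\binom{s+l}{l}}\binom{i}{s+l+1-i}\sum_{j=0}^{2i-s-l-1}(-4)^{j}\binom{2i-s-l-1}{j}\binom{n+2s+2l+1-i+j}{4s+4l+3-2i+2j}\binom{2s+2l+2-2i}{s+1-j}.$$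
   Context: $\mathbb{N}$ is the set of positive integers. For $n\in\mathbb{N}$, a complex number $q$ with $q^m\neq 1$ for all $m\in\mathbb{N}$ with $m<n$, and a multi-index $(k_1,\ldots,k_d)\in\mathbb{N}^d$, the finite multiple harmonic $q$-series is $$z_n(k_1,\ldots,k_d;q)=\sum_{n>m_1>\cdots>m_d>0}\frac{q^{(k_1-1)m_1+\cdots+(k_d-1)m_d}}{[m_1]^{k_1}\cdots[m_d]^{k_d}},\qquad [m]=\frac{1-q^m}{1-q},$$ where $m_1,\dots,m_d$ are integers. An empty sum is $0$ (including the inner sum over $j$ in $A(n,l,s)$ when $2i-s-l-1<0$), and for the empty multi-index ($d=0$) one sets $z_n(\emptyset;q)=1$. The notation $\{a\}^{m}$ means $a$ repeated $m$ times. Binomial coefficients $\binom{a}{b}$ with integers $a\ge 0$ are $0$ if $b<0$ or $b>a$; $0^0=1$. *)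

(* Defs.v *)
From mathcomp Require Import all_boot all_order all_algebra.
From mathcomp.real_closed Require Export complex.
From mathcomp Require Export reals.

Set Implicit Arguments.
Unset Strict Implicit.
Unset Printing Implicit Defensive.

Import GRing.Theory.
Local Open Scope ring_scope.

Section HarmonicQSeries.

Variable F : fieldType.

Definition qint (q : F) (m : nat) : F := (1 - q ^+ m) / (1 - q).

(* z_n(k_1, ..., k_d; q), with k = [:: k_1; ...; k_d] a sequence of positive
   integers and the outer sum over the d-tuples n > m_1 > ... > m_d > 0. The
   bound n > m_i comes from the type 'I_n. For d = 0 the only summand is the
   empty product 1. No denominator vanishes when q ^+ m != 1 for 0 < m < n. *)
Definition mhqs (n : nat) (k : seq nat) (q : F) : F :=
  \sum_(m : (size k).-tuple 'I_n
         | sorted gtn [seq val x | x <- m] && all (leq 1) [seq val x | x <- m])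
    \prod_(i < size k)
      (q ^+ ((nth 0%N k i).-1 * tnth m i) / qint q (tnth m i) ^+ nth 0%N k i).

(* ({3}^{d_0}, 4, {3}^{d_1}, 4, ..., 4, {3}^{d_s}) for d = [:: d_0; ...; d_s] *)
Definition index34 (d : seq nat) : seq nat :=
  nseq (head 0%N d) 3 ++ flatten [seq 4 :: nseq e 3 | e <- behead d].

(* The constraint d_0 + ... + d_s = l forces d_i <= l, hence the type 'I_l.+1. *)
Definition W3 (n l s : nat) (q : F) : F :=
  \sum_(d : s.+1.-tuple 'I_l.+1 | (\sum_(i < s.+1) tnth d i)%N == l)
    mhqs n (index34 [seq val x | x <- d]) q.

(* Binomial coefficient with a possibly negative lower argument. *)
Definition binz (a : nat) (b : int) : nat :=
  if b is Posz k then 'C(a, k) else 0%N.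

(* The inner sum runs over 0 <= j <= 2i - s - l - 1, i.e. j < 2i - (s + l), and
   is empty when 2i <= s + l. In the ranges of i and j, no natural subtraction
   below is truncated; s + 1 - j can be negative and is taken in int. *)
Definition A3 (n l s : nat) : F :=
  \sum_(1 <= i < (s + l + 1).+1)
    - (s + 1)%:R / (i%:R * 'C(s + l, l)%:R) * 'C(i, s + l + 1 - i)%:R *
    \sum_(0 <= j < 2 * i - (s + l))
      (- 4%:R) ^+ j * 'C(2 * i - s - l - 1, j)%:R *
      'C(n + 2 * s + 2 * l + 1 - i + j, 4 * s + 4 * l + 3 - 2 * i + 2 * j)%:R *
      (binz (2 * s + 2 * l + 2 - 2 * i) ((s + 1)%:Z - j%:Z))%:R.

End HarmonicQSeries.

Arguments A3 F n l s : clear implicits.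

(* Main.v *)
(* With u = 1 - zeta and t = zeta^m, the generating function
     sum_(l, s) W3(l, s) u^(-3l-4s) x^l y^s
       = prod_(0 < m < n) (1 + x t^2 / (1 - t)^3 + y t^3 / (1 - t)^4)
   becomes, after multiplication by y n^4, the product over all n-th roots of
   unity t of the quartic P(t) = (1 - t)^4 + x t^2 (1 - t) + y t^3.  If a, b, c,
   d are the roots of P then abcd = 1, and this product is
     (1 - a^n)(1 - b^n)(1 - c^n)(1 - d^n)
       = 2 - p_n(a, ..., d) - p_n(abc, ..., bcd) + p_n(ab, ac, ..., cd)
   with p_n the n-th power sum.  Each family w_1, ..., w_k satisfies
     prod_i (1 - w_i z) = (1 - z)^k (1 - h(z))
   with h one of, for Z = z / (1 - z)^2,
     x z / (1 - z)^3 - y z / (1 - z)^4,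
     - x z^2 / (1 - z)^3 - y z^3 / (1 - z)^4,
     x Z + 4 y Z^2 + (x - y)^2 Z^3
   and the logarithmic derivative gives p_n = k + n [z^n] sum_i h^i / i.  The
   three families yield the two binomial coefficients and A(n, l, s).  The
   identity is checked at numerical points (x, y) of the closed field and then
   read off coefficientwise. *)
Require Import Defs.
From mathcomp Require Import all_boot all_order all_algebra.
From mathcomp.real_closed Require Import complex.
From mathcomp Require Import reals.
From mathcomp Require Import zify ring.

Set Implicit Arguments.
Unset Strict Implicit.
Unset Printing Implicit Defensive.

Import GRing.Theory Num.Theory.
Local Open Scope ring_scope.

(** * Truncated geometric series *)

(** Stands for 1 / (1 - X): it inverts 1 - X modulo X^(N+1), so the whole argument stays within
    polynomials. *)
Definition geom (R : nzRingType) (N : nat) : {poly R} := \poly_(i < N.+1) 1.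
Arguments geom R N : clear implicits.

Lemma geom_sumX (R : nzRingType) N : geom R N = \sum_(i < N.+1) 'X^i.
Proof. by rewrite /geom poly_def; apply: eq_bigr => i _; rewrite scale1r. Qed.

Lemma sum_geom (R : pzRingType) (x : R) n :
  (1 - x) * (\sum_(i < n) x ^+ i) = 1 - x ^+ n.
Proof. by rewrite -[RHS]opprB subrX1 -[in RHS]mulNr opprB. Qed.

Lemma geom_inv (R : comNzRingType) N : (1 - 'X) * geom R N = 1 - 'X^(N.+1).
Proof. by rewrite geom_sumX sum_geom. Qed.

Lemma map_geom (R S : comNzRingType) (f : {rmorphism R -> S}) N :
  map_poly f (geom R N) = geom S N.
Proof.
by rewrite !geom_sumX raddf_sum; apply: eq_bigr => i _; rewrite /= map_polyXn.
Qed.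

Lemma sum_bin_diag r d : (\sum_(j < d.+1) 'C(j + r, r))%N = 'C(d + r.+1, r.+1).
Proof.
elim: d => [|d IH]; first by rewrite big_ord_recr big_ord0 /= !add0n !binn.
by rewrite big_ord_recr /= IH [(d.+1 + r.+1)%N]addSn binS addSnnS.
Qed.

(** Multiplication by [geom] takes partial sums of coefficients as long as the degree is at most N,
    so the hockey-stick identity gives the induction step. *)
Lemma coef_geomX (R : comNzRingType) N r d : (d <= N)%N ->
  (geom R N ^+ r.+1)`_d = 'C(d + r, r)%:R.
Proof.
elim: r d => [|r IH] d le_dN; first by rewrite coef_poly ltnS le_dN bin0.
rewrite exprSr coefM -sum_bin_diag natr_sum; apply: eq_bigr => j _.
have le_jN : (j <= N)%N by apply: leq_trans le_dN; rewrite -ltnS.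
rewrite IH // coef_poly ltnS (leq_trans (leq_subr _ _) le_dN).
by rewrite mulr1.
Qed.

(** * Logarithmic derivatives modulo a power of X *)

(* [p' + p P = 0] modulo [X^N], i.e. [P] is the opposite of the logarithmic
   derivative of [p]. *)
Definition logder (F : fieldType) (N : nat) (p P : {poly F}) :=
  'X^N %| p^`() + p * P.

Lemma logderM (F : fieldType) N (p q P Q : {poly F}) :
  logder N p P -> logder N q Q -> logder N (p * q) (P + Q).
Proof.
rewrite /logder => hp hq; rewrite derivM.
have -> : p^`() * q + p * q^`() + p * q * (P + Q) =
  q * (p^`() + p * P) + p * (q^`() + q * Q) by ring.
by rewrite dvdp_add // dvdp_mull.
Qed.

Lemma logderX (F : fieldType) N (p P : {poly F}) d :
  logder N p P -> logder N (p ^+ d) (P *+ d).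
Proof.
move=> hp; elim: d => [|d IH].
  by rewrite /logder expr0 mulr0n derivC mulr0 addr0 dvdp0.
by rewrite exprS mulrS; apply: logderM.
Qed.

Lemma logder_prod (F : fieldType) N (T : Type) (r : seq T)
  (p P : T -> {poly F}) :
  (forall i, logder N (p i) (P i)) ->
  logder N (\prod_(i <- r) p i) (\sum_(i <- r) P i).
Proof.
move=> h; elim: r => [|i r IH].
  by rewrite /logder !big_nil derivC mulr0 addr0 dvdp0.
by rewrite !big_cons; apply: logderM.
Qed.

(** A congruence modulo X^(N+1) loses one degree when differentiated, so Q also serves for p modulo
    X^N. Then p (P - Q) is divisible by X^N, and p is coprime to X because its constant term is
    nonzero. *)
Lemma logder_uniq (F : fieldType) N (p q P Q : {poly F}) :
  p`_0 != 0 -> 'X^(N.+1) %| p - q -> logder N p P -> logder N q Q ->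
  'X^N %| P - Q.
Proof.
move=> p0 /dvdpP[S Spq] hp hq.
have hq' : logder N p Q.
  rewrite /logder.
  have -> : p = q + S * 'X^(N.+1) by rewrite -Spq; ring.
  rewrite derivD derivM derivXn /= -mulr_natl exprS.
  have -> : q^`() + (S^`() * ('X * 'X^N) + S * (N.+1%:R * 'X^N)) +
      (q + S * ('X * 'X^N)) * Q =
    (q^`() + q * Q) + (S^`() * 'X + S * N.+1%:R + S * 'X * Q) * 'X^N by ring.
  by rewrite dvdp_add // dvdp_mull.
have : 'X^N %| p * (P - Q).
  have -> : p * (P - Q) = (p^`() + p * P) - (p^`() + p * Q) by ring.
  exact: dvdp_sub.
rewrite Gauss_dvdpr // coprimep_expl // coprimep_sym coprimepX.
by rewrite /root horner_coef0.
Qed.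

(** The series is a / (1 - a X) truncated; its coefficients are the powers of a, which is how power
    sums enter. *)
Lemma logder_linear (F : fieldType) N (a : F) :
  logder N (1 - a%:P * 'X) (\sum_(k < N) (a ^+ k.+1)%:P * 'X^k).
Proof.
rewrite /logder.
have -> : \sum_(k < N) (a ^+ k.+1)%:P * 'X^k =
          a%:P * \sum_(k < N) (a%:P * 'X) ^+ k :> {poly F}.
  rewrite mulr_sumr; apply: eq_bigr => k _.
  by rewrite exprMn -polyC_exp mulrA -polyCM -exprS.
rewrite mulrCA.
rewrite sum_geom.
rewrite derivB derivM !derivC derivX exprMn.
have -> : 0 - (0 * 'X + a%:P * 1) + a%:P * (1 - a%:P ^+ N * 'X^N) =
          - (a%:P * a%:P ^+ N) * 'X^N by ring.
by rewrite dvdp_mull.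
Qed.

Lemma logder_geom (F : fieldType) N : logder N (geom F N) (- geom F N).
Proof.
rewrite /logder.
set E := geom F N.
have h1 : (1 - 'X) * E = 1 - 'X * 'X^N by rewrite geom_inv exprS.
(* Derivative of (1 - X) E = 1 - X^(N+1). *)
have h2 : (1 - 'X) * E^`() - E = - (N.+1%:R * 'X^N).
  have := congr1 (@deriv F) (geom_inv F N).
  rewrite derivM !derivB derivC derivX derivXn /= -/E -mulr_natl => h.
  by rewrite -[RHS]sub0r -h; ring.
have : 'X^N %| (1 - 'X) * (E^`() + E * - E).
  have -> : (1 - 'X) * (E^`() + E * - E) =
    ((1 - 'X) * E^`() - E) + E - E * ((1 - 'X) * E) by ring.
  rewrite h2 h1.
  have -> : - (N.+1%:R * 'X^N) + E - E * (1 - 'X * 'X^N) =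
    (E * 'X - N.+1%:R) * 'X^N by ring.
  by rewrite dvdp_mull.
rewrite Gauss_dvdpr // coprimep_expl // coprimep_sym coprimepX.
by rewrite /root !hornerE subr0 oner_eq0.
Qed.

(** The sum is h' / (1 - h) cut off at h^N, which X^N divides since h has no constant term. *)
Lemma logder_1Bh (F : fieldType) N (h : {poly F}) : h`_0 = 0 ->
  logder N (1 - h) (\sum_(i < N) h^`() * h ^+ i).
Proof.
move=> h0; rewrite /logder -mulr_sumr mulrCA.
rewrite sum_geom.
rewrite derivB derivC.
have -> : 0 - h^`() + h^`() * (1 - h ^+ N) = - h^`() * h ^+ N by ring.
rewrite dvdp_mull // dvdp_exp2r // -['X]subr0 -polyC0 dvdp_XsubCl.
by rewrite /root horner_coef0 h0.
Qed.

Lemma coef_dvdXn (F : fieldType) N (p : {poly F}) i :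
  'X^N %| p -> (i < N)%N -> p`_i = 0.
Proof. by move=> /dvdpP[q ->] lt_iN; rewrite coefMXn lt_iN. Qed.

(** Compare the coefficients of X^(n-1) in the two logarithmic derivatives. The linear factors give
    the power sum and [geom] to the power d gives - d; on the other side h' h^i is the derivative of
    h^(i+1) / (i+1), whence the factor n / (i+1). *)
Lemma power_sum_log (F : numFieldType) N d (r : seq F) (h : {poly F}) n :
  h`_0 = 0 ->
  'X^(N.+1) %| \prod_(a <- r) (1 - a%:P * 'X) * geom F N ^+ d - (1 - h) ->
  (0 < n <= N)%N ->
  \sum_(a <- r) a ^+ n =
    d%:R + n%:R * \sum_(1 <= i < N.+1) i%:R^-1 * (h ^+ i)`_n.
Proof.
move=> h0 hQ; case: n => [//|n] /= le_nN.
set Q := _ * _ in hQ.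
have Q0 : Q`_0 != 0.
  have /eqP := coef_dvdXn hQ (ltn0Sn N).
  by rewrite !coefB h0 coef1 subr0 subr_eq0 => /eqP->; rewrite oner_eq0.
have hLQ := logderM (logder_prod r (@logder_linear F N))
  (logderX d (logder_geom F N)).
have /coef_dvdXn/(_ le_nN)/eqP := logder_uniq Q0 hQ hLQ (logder_1Bh N h0).
rewrite coefB subr_eq0 coefD !coef_sum coefMn coefN coef_poly ltnS (ltnW le_nN).
have -> : \sum_(a <- r) (\sum_(k < N) (a ^+ k.+1)%:P * 'X^k)`_n =
          \sum_(a <- r) a ^+ n.+1.
  apply: eq_bigr => a _; rewrite coef_sum (bigD1 (Ordinal le_nN)) //=.
  rewrite coefCM coefXn eqxx mulr1 big1 ?addr0 // => k neq_kn.
  by rewrite -val_eqE eq_sym /= in neq_kn;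
    rewrite coefCM coefXn (negbTE neq_kn) mulr0.
rewrite mulNrn subr_eq => /eqP->; rewrite addrC; congr (_ + _).
rewrite big_add1 big_mkord mulr_sumr; apply: eq_bigr => i _.
have := coef_deriv (h ^+ i.+1) n; rewrite deriv_exp /=.
rewrite mulrCA mulr_natl => <-.
have i1 : i.+1%:R != 0 :> F by rewrite pnatr_eq0.
by rewrite coefMn -(mulr_natl _`_n) mulrA mulVf // mul1r.
Qed.

(** * Power sums attached to the four roots of the quartic *)

(** The ring is arbitrary because x and y are taken first as numbers, where roots exist, and later
    as indeterminates, where coefficients are read off. *)
Definition log1 (R : comNzRingType) N (x y : R) : {poly R} :=
  'X * geom R N ^+ 3 * (x%:P - y%:P * geom R N).

Definition log2 (R : comNzRingType) N (x y : R) : {poly R} :=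
  - ('X^2 * geom R N ^+ 3 * (x%:P + y%:P * ('X * geom R N))).

Definition log3 (R : comNzRingType) N (x y : R) : {poly R} :=
  (x%:P * ('X * geom R N ^+ 2) + 4%:R * y%:P * ('X * geom R N ^+ 2) ^+ 2)
    + (x - y)%:P ^+ 2 * ('X * geom R N ^+ 2) ^+ 3.

Section FourRoots.
Variables (F : numFieldType) (x y a b c d : F).
Hypotheses (e1 : a + b + c + d = 4%:R + x - y)
  (e2 : a * b + a * c + a * d + b * c + b * d + c * d = 6%:R + x)
  (e3 : a * b * c + a * b * d + a * c * d + b * c * d = 4%:R)
  (e4 : a * b * c * d = 1).

(** The reversed quartic is (1 - X)^4 - x X (1 - X) + y X; dividing by (1 - X)^4 gives 1 - h. *)
Lemma power_sum_roots n N : (0 < n <= N)%N ->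
  a ^+ n + b ^+ n + c ^+ n + d ^+ n =
    4%:R + n%:R * \sum_(1 <= i < N.+1) i%:R^-1 * (log1 N x y ^+ i)`_n.
Proof.
move=> /(@power_sum_log F N 4 [:: a; b; c; d] (log1 N x y) n) <-; first last.
- rewrite !big_cons big_nil.
  have -> : (1 - a%:P * 'X) * ((1 - b%:P * 'X) * ((1 - c%:P * 'X) *
      ((1 - d%:P * 'X) * 1))) =
      1 - (a + b + c + d)%:P * 'X
        + (a * b + a * c + a * d + b * c + b * d + c * d)%:P * 'X^2
        - (a * b * c + a * b * d + a * c * d + b * c * d)%:P * 'X^3
        + (a * b * c * d)%:P * 'X^4.
    by rewrite !polyCD !polyCM; ring.
  rewrite e1 e2 e3 e4 /log1; set E := geom F N.
  rewrite polyCB !(polyCD _ x) !polyC_natr polyC1.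
  set X := x%:P; set Y := y%:P.
  have h : (1 - 'X) * E = 1 - 'X^(N.+1) by rewrite geom_inv.
  set T := 'X^(N.+1) in h *.
  (* Once (1 - X) E is replaced by 1 - T, the difference becomes an explicit multiple of T. *)
  have -> :
    (1 - (4%:R + X - Y) * 'X + (6%:R + X) * 'X^2 - 4%:R * 'X^3 + 1 * 'X^4) *
       E ^+ 4 - (1 - 'X * E ^+ 3 * (X - Y * E)) =
       ((1 - 'X) * E) ^+ 4 - 1 - X * 'X * E ^+ 3 * ((1 - 'X) * E - 1) by ring.
  rewrite h; have -> : (1 - T) ^+ 4 - 1 - X * 'X * E ^+ 3 * ((1 - T) - 1) =
    T * (X * 'X * E ^+ 3 - 4%:R + 6%:R * T - 4%:R * T ^+ 2 + T ^+ 3) by ring.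
  exact: dvdp_mulr.
- by rewrite /log1 -!mulrA coefXM.
by rewrite !big_cons big_nil addr0 !addrA.
Qed.

(** Since abcd = 1, the triple products are the inverses of the roots, and the product of the 1 - w
    X is the quartic (1 - X)^4 + x X^2 (1 - X) + y X^3 itself. *)
Lemma power_sum_inv_roots n N : (0 < n <= N)%N ->
  (a * b * c) ^+ n + (a * b * d) ^+ n + (a * c * d) ^+ n + (b * c * d) ^+ n =
    4%:R + n%:R * \sum_(1 <= i < N.+1) i%:R^-1 * (log2 N x y ^+ i)`_n.
Proof.
move=> /(@power_sum_log F N 4 [:: a * b * c; a * b * d; a * c * d; b * c * d]
  (log2 N x y) n) <-; first last.
- rewrite !big_cons big_nil.
  have -> : (1 - (a * b * c)%:P * 'X) * ((1 - (a * b * d)%:P * 'X) *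
      ((1 - (a * c * d)%:P * 'X) * ((1 - (b * c * d)%:P * 'X) * 1))) =
      1 - (a * b * c + a * b * d + a * c * d + b * c * d)%:P * 'X
        + (a * b * c * d)%:P *
          (a * b + a * c + a * d + b * c + b * d + c * d)%:P * 'X^2
        - (a * b * c * d)%:P ^+ 2 * (a + b + c + d)%:P * 'X^3
        + (a * b * c * d)%:P ^+ 3 * 'X^4.
    by rewrite !polyCD !polyCM; ring.
  rewrite e1 e2 e3 e4 /log2; set E := geom F N.
  rewrite polyCB !(polyCD _ x) !polyC_natr polyC1.
  set X := x%:P; set Y := y%:P.
  have h : (1 - 'X) * E = 1 - 'X^(N.+1) by rewrite geom_inv.
  set T := 'X^(N.+1) in h *.
  have -> :
    (1 - 4%:R * 'X + 1 * (6%:R + X) * 'X^2 - 1 ^+ 2 * (4%:R + X - Y) * 'X^3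
       + 1 ^+ 3 * 'X^4) * E ^+ 4 - (1 - -
         ('X^2 * E ^+ 3 * (X + Y * ('X * E)))) =
       ((1 - 'X) * E) ^+ 4 - 1 + X * 'X^2 * E ^+ 3 * ((1 - 'X) * E - 1) by ring.
  rewrite h; have -> : (1 - T) ^+ 4 - 1 + X * 'X^2 * E ^+ 3 * ((1 - T) - 1) =
    T * (- (X * 'X^2 * E ^+ 3) - 4%:R + 6%:R * T - 4%:R * T ^+ 2 + T ^+ 3) by
      ring.
  exact: dvdp_mulr.
- by rewrite /log2 coefN -[_ * _ * _]mulrA coefXnM oppr0.
by rewrite !big_cons big_nil addr0 !addrA.
Qed.

(** The sextic of the pair products is palindromic because abcd = 1, so after division by (1 - X)^6
    it is a polynomial in X / (1 - X)^2. *)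
Lemma power_sum_pair_roots n N : (0 < n <= N)%N ->
  (a * b) ^+ n + (a * c) ^+ n + (a * d) ^+ n + (b * c) ^+ n + (b * d) ^+ n
    + (c * d) ^+ n =
    6%:R + n%:R * \sum_(1 <= i < N.+1) i%:R^-1 * (log3 N x y ^+ i)`_n.
Proof.
move=> /(@power_sum_log F N 6 [:: a * b; a * c; a * d; b * c; b * d; c * d]
  (log3 N x y) n) <-; first last.
- rewrite !big_cons big_nil.
  pose s1 := a + b + c + d; have es1 := e1; rewrite -/s1 in es1.
  pose s2 := a * b + a * c + a * d + b * c + b * d + c * d; have es2 := e2;
    rewrite -/s2 in es2.
  pose s3 := a * b * c + a * b * d + a * c * d + b * c * d; have es3 := e3;
    rewrite -/s3 in es3.
  pose s4 := a * b * c * d; have es4 := e4; rewrite -/s4 in es4.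
  (* Coefficients of the sextic in terms of the elementary symmetric functions of the four roots. *)
  have -> : (1 - (a * b)%:P * 'X) * ((1 - (a * c)%:P * 'X) *
      ((1 - (a * d)%:P * 'X) * ((1 - (b * c)%:P * 'X) * ((1 - (b * d)%:P * 'X)
      * ((1 - (c * d)%:P * 'X) * 1))))) =
      1 - s2%:P * 'X
        + (s1%:P * s3%:P - s4%:P) * 'X^2
        - (s1%:P ^+ 2 * s4%:P + s3%:P ^+ 2 - 2%:R * s2%:P * s4%:P) * 'X^3
        + s4%:P * (s1%:P * s3%:P - s4%:P) * 'X^4
        - s2%:P * s4%:P ^+ 2 * 'X^5
        + s4%:P ^+ 3 * 'X^6.
    by rewrite /s1 /s2 /s3 /s4 !polyCD !polyCM; ring.
  rewrite es1 es2 es3 es4 /log3; set E := geom F N.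
  rewrite !polyCB !(polyCD _ x) !polyC_natr polyC1.
  set X := x%:P; set Y := y%:P.
  have h : (1 - 'X) * E = 1 - 'X^(N.+1) by rewrite geom_inv.
  set T := 'X^(N.+1) in h *.
  have -> : (1 - (6%:R + X) * 'X + ((4%:R + X - Y) * 4%:R - 1) * 'X^2
     - ((4%:R + X - Y) ^+ 2 * 1 + 4%:R ^+ 2 - 2%:R * (6%:R + X) * 1) * 'X^3
     + 1 * ((4%:R + X - Y) * 4%:R - 1) * 'X^4 - (6%:R + X) * 1 ^+ 2 * 'X^5
     + 1 ^+ 3 * 'X^6) * E ^+ 6
     - (1 - (X * ('X * E ^+ 2) + 4%:R * Y * ('X * E ^+ 2) ^+ 2
             + (X - Y) ^+ 2 * ('X * E ^+ 2) ^+ 3)) =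
       ((1 - 'X) * E) ^+ 6 - 1 - X * 'X * E ^+ 2 * (((1 - 'X) * E) ^+ 4 - 1)
       - 4%:R * Y * 'X^2 * E ^+ 4 * (((1 - 'X) * E) ^+ 2 - 1) by ring.
  rewrite h; have -> : (1 - T) ^+ 6 - 1 - X * 'X * E ^+ 2 * ((1 - T) ^+ 4 - 1)
       - 4%:R * Y * 'X^2 * E ^+ 4 * ((1 - T) ^+ 2 - 1) =
    T * ((T - 2%:R) * ((1 - T) ^+ 4 + (1 - T) ^+ 2 + 1
          - X * 'X * E ^+ 2 * ((1 - T) ^+ 2 + 1) - 4%:R * Y * 'X^2 * E ^+
              4)) by ring.
  exact: dvdp_mulr.
- have -> : log3 N x y = 'X * (x%:P * geom F N ^+ 2
      + 4%:R * y%:P * 'X * geom F N ^+ 4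
      + (x - y)%:P ^+ 2 * 'X^2 * geom F N ^+ 6) by rewrite /log3; ring.
  by rewrite coefXM.
by rewrite !big_cons big_nil addr0 !addrA.
Qed.

(** Expanding the product leaves the constant 1 + (abcd)^n = 2, which cancels the 6 - 4 - 4 coming
    from the three power sums. *)
Lemma prod_1subX_roots n N : (0 < n <= N)%N ->
  (1 - a ^+ n) * (1 - b ^+ n) * (1 - c ^+ n) * (1 - d ^+ n) =
    n%:R * \sum_(1 <= i < N.+1) i%:R^-1 *
      ((log3 N x y ^+ i)`_n - (log1 N x y ^+ i)`_n - (log2 N x y ^+ i)`_n).
Proof.
move=> hn; under eq_bigr do rewrite !mulrBr.
rewrite !big_split /= !sumrN !mulrDr !mulrN.
have h1 := power_sum_roots hn; have h2 := power_sum_inv_roots hn.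
have h3 := power_sum_pair_roots hn.
transitivity ((a * b) ^+ n + (a * c) ^+ n + (a * d) ^+ n + (b * c) ^+ n
  + (b * d) ^+ n + (c * d) ^+ n - (a ^+ n + b ^+ n + c ^+ n + d ^+ n)
  - ((a * b * c) ^+ n + (a * b * d) ^+ n + (a * c * d) ^+ n + (b * c * d) ^+ n)
  + 2%:R); last by rewrite h1 h2 h3; ring.
have : (a * b * c * d) ^+ n = 1 by rewrite e4 expr1n.
rewrite !exprMn => e4n.
transitivity ((1 - a ^+ n) * (1 - b ^+ n) * (1 - c ^+ n) * (1 - d ^+ n)
  - (a ^+ n * b ^+ n * c ^+ n * d ^+ n - 1)); first by rewrite e4n; ring.
ring.
Qed.

End FourRoots.

(** * Products over the roots of unity *)

Lemma quartic_roots (F : closedFieldType) (x y : F) :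
  exists a b c d : F, [/\ a + b + c + d = 4%:R + x - y,
    a * b + a * c + a * d + b * c + b * d + c * d = 6%:R + x,
    a * b * c + a * b * d + a * c * d + b * c * d = 4%:R &
    a * b * c * d = 1].
Proof.
(* Coefficients of (1 - t)^4 + x t^2 (1 - t) + y t^3, lowest degree first; the conclusion is Vieta's
   formulas. *)
pose s := [:: 1; - 4%:R; 6%:R + x; y - x - 4%:R; 1] : seq F.
have sK : Poly s = s :> seq F by apply: (@PolyK _ 0); rewrite /= oner_neq0.
have [r] := closed_field_poly_normal (Poly s).
have -> : lead_coef (Poly s) = 1 by rewrite lead_coefE sK.
rewrite scale1r => Er; have := size_prod_XsubC r id; rewrite -Er sK /=.
case: r Er => [|a [|b [|c [|d [|]]]]] // Er _; exists a, b, c, d.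
have {}Er : Poly s = Poly [:: a * b * c * d;
    - (a * b * c + a * b * d + a * c * d + b * c * d);
    a * b + a * c + a * d + b * c + b * d + c * d; - (a + b + c + d); 1].
  rewrite Er !big_cons big_nil /= !cons_poly_def.
  rewrite !(polyCN, polyCD, polyCM) polyC1; ring.
have E i := congr1 (fun p : {poly F} => p`_i) Er.
split.
- by have := E 3; rewrite !coef_Poly /= => /(congr1 -%R); rewrite opprK => <-;
    ring.
- by have := E 2; rewrite !coef_Poly.
- by have := E 1; rewrite !coef_Poly /= => /oppr_inj.
- by have := E 0; rewrite !coef_Poly.
Qed.

Lemma prod_sub_unity_roots (F : fieldType) n (z a : F) : n.-primitive_root z ->
  \prod_(0 <= m < n) (a - z ^+ m) = a ^+ n - 1.
Proof.
move=> /factor_Xn_sub_1 /(congr1 (fun p => p.[a])).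
rewrite horner_prod !hornerE => <-.
by apply: eq_bigr => i _; rewrite !hornerE.
Qed.

(** Cancel X - 1 in the factorization of X^n - 1 and evaluate the quotient 1 + X + ... + X^(n-1) at
    1. *)
Lemma prod_1sub_unity_roots (F : fieldType) n (z : F) : n.-primitive_root z ->
  \prod_(1 <= m < n) (1 - z ^+ m) = n%:R.
Proof.
move=> zP; have n_gt0 := prim_order_gt0 zP.
have := factor_Xn_sub_1 zP; rewrite big_ltn // expr0 subrX1 polyC1.
move=> /mulfI; rewrite polyXsubC_eq0 => /(_ isT) /(congr1 (fun p => p.[1])).
rewrite horner_prod horner_sum.
under eq_bigr do rewrite !hornerE.
under [RHS]eq_bigr do rewrite !hornerE expr1n.
by rewrite sumr_const card_ord.
Qed.

Lemma prod_unity_roots (F : numClosedFieldType) n (z x y : F) N :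
  n.-primitive_root z -> (n <= N)%N ->
  n%:R ^+ 4 * y * \prod_(1 <= m < n)
     (1 + x * (z ^+ m ^+ 2 / (1 - z ^+ m) ^+ 3)
        + y * (z ^+ m ^+ 3 / (1 - z ^+ m) ^+ 4)) =
  n%:R * \sum_(1 <= i < N.+1) i%:R^-1 *
    ((log3 N x y ^+ i)`_n - (log1 N x y ^+ i)`_n - (log2 N x y ^+ i)`_n).
Proof.
move=> zP le_nN; have n_gt0 := prim_order_gt0 zP.
have [a [b [c [d [e1 e2 e3 e4]]]]] := quartic_roots x y.
have hn : (0 < n <= N)%N by rewrite n_gt0.
rewrite -(prod_1subX_roots e1 e2 e3 e4 hn).
transitivity (\prod_(0 <= m < n)
   ((a - z ^+ m) * (b - z ^+ m) * (c - z ^+ m) * (d - z ^+ m))).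
  rewrite [RHS]big_ltn // expr0 -(prod_1sub_unity_roots zP).
  have P t : (a - t) * (b - t) * (c - t) * (d - t) =
      (1 - t) ^+ 4 + x * t ^+ 2 * (1 - t) + y * t ^+ 3.
    transitivity (t ^+ 4 - (a + b + c + d) * t ^+ 3
      + (a * b + a * c + a * d + b * c + b * d + c * d) * t ^+ 2
      - (a * b * c + a * b * d + a * c * d + b * c * d) * t + a * b * c * d).
      ring.
    rewrite e1 e2 e3 e4; ring.
  (* The factor at t = 1 is y, and n^4 supplies (1 - z^m)^4 to each remaining factor. *)
  rewrite P subrr expr0n /= mulr0 !add0r expr1n mulr1 [_ * y]mulrC -mulrA;
    congr (_ * _).
  rewrite -prodrXl -big_split /=; apply: eq_big_nat => m /andP[m_gt0 lt_mn].
  rewrite P; have : 1 - z ^+ m != 0.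
    by rewrite subr_eq0 eq_sym -(prim_order_dvd zP) gtnNdvd.
  by move: (z ^+ m) => t t1; field.
rewrite !big_split /= !(prod_sub_unity_roots _ zP).
by rewrite -[a ^+ n - 1]opprB -[b ^+ n - 1]opprB -[c ^+ n - 1]opprB
  -[d ^+ n - 1]opprB; ring.
Qed.

(** * From numerical points to coefficients *)

Lemma poly_ext_nat (R : idomainType) (p q : {poly R}) :
  injective (fun k : nat => k%:R : R) ->
  (forall k : nat, p.[k%:R] = q.[k%:R]) -> p = q.
Proof.
move=> inj_nat pq; apply/eqP; rewrite -subr_eq0; apply/eqP.
pose rs : seq R := [seq k%:R | k <- iota 0 (size (p - q))].
apply: (@roots_geq_poly_eq0 _ _ rs).
- by apply/allP => _ /mapP[k _ ->]; rewrite /root !hornerE pq subrr.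
- by rewrite map_inj_uniq ?iota_uniq.
- by rewrite size_map size_iota.
Qed.

Lemma poly2_ext_nat (F : numDomainType) (p q : {poly {poly F}}) :
  (forall j k : nat, p.[j%:R].[k%:R] = q.[j%:R].[k%:R]) -> p = q.
Proof.
have inj_nat : injective (fun k : nat => k%:R : F).
  by move=> j k /eqP; rewrite eqr_nat => /eqP.
move=> pq; apply: poly_ext_nat => [j k|j].
  by rewrite -!polyC_natr => /polyC_inj/inj_nat.
exact: poly_ext_nat.
Qed.

(** For n < k the upper index n + r - k is below r, even when the subtraction truncates to 0, since
    r > 0; the binomial coefficient then vanishes as it should. *)
Lemma coefXn_geomX (R : comNzRingType) N n k r : (n <= N)%N -> (0 < r)%N ->
  ('X^k * geom R N ^+ r.+1)`_n = 'C(n + r - k, r)%:R.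
Proof.
move=> le_nN r_gt0; rewrite coefXnM; case: ltnP => [lt_nk|le_kn].
  by rewrite bin_small //; lia.
by rewrite coef_geomX ?(leq_trans (leq_subr _ _)) // addnBAC.
Qed.

Section Coefficients.
Variables (F : numFieldType) (N n : nat).
Hypothesis le_nN : (n <= N)%N.

(* With x = lam and y = lam * mu the exponent of lam is the total degree in
   (x, y). *)
Let lam : {poly {poly F}} := 'X.
Let mu : {poly {poly F}} := 'X%:P.

Lemma coef_log1 i : (0 < i)%N ->
  (log1 N lam (lam * mu) ^+ i)`_n = lam ^+ i *
   (\poly_(j < i.+1) ((-1) ^+ j * 'C(i, j)%:R
      * 'C(n + 2 * i + j - 1, 3 * i + j - 1)%:R))%:P.
Proof.
move=> i_gt0; rewrite /log1; set E := geom _ N.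
rewrite exprMn exprBn mulr_sumr coef_sum poly_def rmorph_sum mulr_sumr.
apply: eq_bigr => -[j /= le_ji] _; rewrite ltnS in le_ji.
have -> : ('X * E ^+ 3) ^+ i * ((-1) ^+ j * lam%:P ^+ (i - j)
    * ((lam * mu)%:P * E) ^+ j *+ 'C(i, j)) =
  ((-1) ^+ j * 'C(i, j)%:R * (lam ^+ (i - j) * lam ^+ j) * mu ^+ j)%:P *
    ('X^i * (E ^+ (3 * i) * E ^+ j)).
  rewrite -(mulr_natr (_ * _)) !polyCM !polyC_exp polyCN polyC1 polyC_natr
    exprM.
  rewrite !exprMn; ring.
rewrite -!exprD subnK // coefCM.
have -> : (3 * i + j = (3 * i + j - 1).+1)%N by lia.
rewrite coefXn_geomX //; last by lia.
have -> : (n + (3 * i + j - 1) - i = n + 2 * i + j - 1)%N by lia.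
rewrite [(_.+1 - 1)%N]subn1 /= -mul_polyC !polyCM !polyC_exp !polyCN !polyC1
  !polyC_natr /mu; ring.
Qed.

Lemma coef_log2 i : (0 < i)%N ->
  (log2 N lam (lam * mu) ^+ i)`_n = lam ^+ i *
   (\poly_(j < i.+1) ((-1) ^+ i * 'C(i, j)%:R
      * 'C(n + i - 1, 3 * i + j - 1)%:R))%:P.
Proof.
move=> i_gt0; rewrite /log2; set E := geom _ N.
rewrite [in LHS]exprNn exprMn exprDn !mulr_sumr coef_sum poly_def rmorph_sum
  mulr_sumr.
apply: eq_bigr => -[j /= le_ji] _; rewrite ltnS in le_ji.
have -> : (-1) ^+ i * (('X^2 * E ^+ 3) ^+ i * (lam%:P ^+ (i - j)
    * ((lam * mu)%:P * ('X * E)) ^+ j *+ 'C(i, j))) =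
  ((-1) ^+ i * 'C(i, j)%:R * (lam ^+ (i - j) * lam ^+ j) * mu ^+ j)%:P *
    (('X^(2 * i) * 'X^j) * (E ^+ (3 * i) * E ^+ j)).
  rewrite -(mulr_natr (_ * _)) !polyCM !polyC_exp polyCN polyC1 polyC_natr
    !exprM.
  rewrite !exprMn; ring.
rewrite -!exprD subnK // coefCM.
have -> : (3 * i + j = (3 * i + j - 1).+1)%N by lia.
rewrite coefXn_geomX //; last by lia.
have -> : (n + (3 * i + j - 1) - (2 * i + j) = n + i - 1)%N by lia.
rewrite [(_.+1 - 1)%N]subn1 /= -mul_polyC !polyCM !polyC_exp !polyCN !polyC1
  !polyC_natr /mu; ring.
Qed.

(** Here c counts the factors (x - y)^2 Z^3 and j the factors 4 y Z^2. Only the former have degree 2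
    in (x, y), hence the exponent i + c; the factor x - y is [lam] (1 - [mu]). *)
Lemma coef_log3 i : (0 < i)%N ->
  (log3 N lam (lam * mu) ^+ i)`_n = \sum_(c < i.+1) lam ^+ (i + c) *
   ('C(i, c)%:R * \sum_(j < (i - c).+1)
      4%:R ^+ j * 'C(i - c, j)%:R
        * 'C(n + (i + 2 * c + j) - 1, 2 * (i + 2 * c + j) - 1)%:R
      * ('X^j * (1 - 'X) ^+ (2 * c)))%:P.
Proof.
move=> i_gt0; rewrite /log3; set E := geom _ N.
rewrite exprDn coef_sum; apply: eq_bigr => -[c /= le_ci] _;
  rewrite ltnS in le_ci.
rewrite exprDn mulr_suml -sumrMnl coef_sum mulr_sumr rmorph_sum mulr_sumr.
apply: eq_bigr => -[j /= le_jic] _; rewrite ltnS in le_jic.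
set Z := 'X * E ^+ 2.
have -> : (lam%:P * Z) ^+ (i - c - j) * (4%:R * (lam * mu)%:P * Z ^+ 2) ^+ j
   *+ 'C(i - c, j) * ((lam - lam * mu)%:P ^+ 2 * Z ^+ 3) ^+ c *+ 'C(i, c) =
  ('C(i, c)%:R * 'C(i - c, j)%:R * 4%:R ^+ j
    * (lam ^+ (i - c - j) * lam ^+ j * lam ^+ (2 * c)) * mu ^+ j
    * (1 - mu) ^+ (2 * c))%:P
  * (Z ^+ (i - c - j) * Z ^+ (2 * j) * Z ^+ (3 * c)).
  rewrite !polyCM !polyC_exp !polyCB !polyCM polyC1 !polyC_natr !exprM.
  have -> : lam%:P - lam%:P * mu%:P = lam%:P * (1 - mu%:P) by ring.
  rewrite -!(mulr_natr (_ * _)) !exprMn; ring.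
rewrite -!exprD coefCM.
have -> : (i - c - j + 2 * j + 3 * c = i + 2 * c + j)%N by lia.
have -> : (i - c - j + j + 2 * c = i + c)%N by lia.
rewrite /Z exprMn -exprM.
have -> : (2 * (i + 2 * c + j) = (2 * (i + 2 * c + j) - 1).+1)%N by lia.
rewrite coefXn_geomX //; last by lia.
have -> : (n + (2 * (i + 2 * c + j) - 1) - (i + 2 * c + j) =
   n + (i + 2 * c + j) - 1)%N by lia.
rewrite [(_.+1 - 1)%N]subn1 /=.
rewrite !polyCM !polyC_exp !polyCB !polyC1 !polyC_natr /mu; ring.
Qed.

End Coefficients.

Section MapLog.
Variables (R S : comNzRingType) (f : {rmorphism R -> S}) (N : nat) (x y : R).

Lemma map_log1 : map_poly f (log1 N x y) = log1 N (f x) (f y).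
Proof.
by rewrite /log1 !(rmorphM, rmorphB, rmorphXn) /= map_polyX map_geom !map_polyC.
Qed.

Lemma map_log2 : map_poly f (log2 N x y) = log2 N (f x) (f y).
Proof.
by rewrite /log2 !(rmorphN, rmorphM, rmorphD, rmorphXn) /= map_polyX map_geom
  !map_polyC.
Qed.

Lemma map_log3 : map_poly f (log3 N x y) = log3 N (f x) (f y).
Proof.
rewrite /log3 !polyCB !(rmorph_nat, rmorphM, rmorphXn, rmorphB, rmorphD) /=.
by rewrite map_polyX map_geom !map_polyC.
Qed.

End MapLog.

(** The outer variable marks every entry and the inner one the entries 4, so s entries 4 and l
    entries 3 sit at the coefficient (s + l, s). *)
Definition gen34 (F : fieldType) n (z : F) : {poly {poly F}} :=
  \prod_(1 <= m < n)
     (1 + 'X * ((z ^+ m ^+ 2 / (1 - z ^+ m) ^+ 3)%:P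
                + (z ^+ m ^+ 3 / (1 - z ^+ m) ^+ 4)%:P * 'X)%:P).

(** Both sides are polynomials in two variables, so it suffices to evaluate at natural numbers j and
    k, that is at x = j and y = j k, where [prod_unity_roots] applies. *)
Lemma gen34_log (F : numClosedFieldType) n (z : F) N :
  n.-primitive_root z -> (n <= N)%N ->
  n%:R ^+ 4 * ('X * 'X%:P) * gen34 n z =
  n%:R * \sum_(1 <= i < N.+1) (i%:R^-1)%:P%:P *
    ((log3 N 'X ('X * 'X%:P) ^+ i)`_n - (log1 N 'X ('X * 'X%:P) ^+ i)`_n
       - (log2 N 'X ('X * 'X%:P) ^+ i)`_n).
Proof.
move=> zP le_nN; apply: poly2_ext_nat => j k.
pose ev : {rmorphism {poly {poly F}} -> F} :=
  horner_eval (k%:R : F) \o horner_eval (j%:R : {poly F}).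
pose x : F := j%:R; pose y : F := j%:R * k%:R.
rewrite -![_.[_].[_]]/(ev _).
have evX : ev 'X = x by rewrite /ev /= /horner_eval !hornerE -polyC_natr
  hornerC.
have evM : ev ('X * 'X%:P) = y.
  by rewrite /ev /= /horner_eval !hornerE -polyC_natr hornerC.
have evC c : ev c%:P%:P = c by rewrite /ev /= /horner_eval !hornerE.
have evG u v : ev (1 + 'X * (u%:P + v%:P * 'X)%:P) = 1 + x * u + y * v.
  have -> : 1 + 'X * (u%:P + v%:P * 'X)%:P =
      1 + 'X * u%:P%:P + 'X * 'X%:P * v%:P%:P :> {poly {poly F}}.
    by rewrite polyCD polyCM; ring.
  rewrite !rmorphD rmorph1 [X in _ + X + _]rmorphM [X in _ + X]rmorphM.
  by rewrite !evC evX evM.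
rewrite [LHS]rmorphM [X in X * _]rmorphM evM [X in X * _ * _]rmorphXn
  rmorph_nat.
have -> : ev (gen34 n z) = \prod_(1 <= m < n)
   (1 + x * (z ^+ m ^+ 2 / (1 - z ^+ m) ^+ 3)
      + y * (z ^+ m ^+ 3 / (1 - z ^+ m) ^+ 4)).
  rewrite /gen34 rmorph_prod; apply: eq_bigr => m _.
  exact: evG.
rewrite (prod_unity_roots x y zP le_nN) [RHS]rmorphM rmorph_nat rmorph_sum.
congr (_ * _); apply: eq_bigr => i _.
rewrite rmorphM evC !rmorphB -!(coef_map ev).
by rewrite !rmorphXn /= map_log1 map_log2 map_log3 evX evM.
Qed.

Lemma coefXn_mulC (R : comNzRingType) (p : R) i d :
  ('X^i * p%:P)`_d = if i == d then p else 0.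
Proof.
by rewrite coefMC coefXn eq_sym; case: eqP => _; rewrite ?mul1r ?mul0r.
Qed.

Lemma coef_1subX_exp (R : comNzRingType) m k :
  ((1 - 'X : {poly R}) ^+ m)`_k = (-1) ^+ k * 'C(m, k)%:R.
Proof.
have -> : (1 - 'X : {poly R}) ^+ m = \poly_(i < m.+1) ((-1) ^+ i * 'C(m, i)%:R).
  rewrite exprBn poly_def; apply: eq_bigr => i _.
  rewrite expr1n mulr1 -mulr_natr -mul_polyC polyCM polyC_exp polyCN polyC1.
  by rewrite polyC_natr -!mulrA ['X^i * _]mulrC.
by rewrite coef_poly; case: ltnP => // ?; rewrite bin_small // mulr0.
Qed.

Section CoefGen.
Variables (F : numClosedFieldType) (n l s N : nat).
Hypothesis le_nN : (n <= N)%N.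

Lemma coef2_log1 i : (0 < i)%N ->
  (log1 N ('X : {poly {poly F}}) ('X * 'X%:P) ^+ i)`_n`_(s + l + 1)`_(s + 1) =
  if i == (s + l + 1)%N then (-1) ^+ (s + 1) * 'C(s + l + 1, s + 1)%:R
    * 'C(n + 3 * s + 2 * l + 2, 4 * s + 3 * l + 3)%:R else 0.
Proof.
move=> i_gt0; rewrite coef_log1 // coefXn_mulC.
case: eqP => [->|_]; last by rewrite coef0.
rewrite coef_poly ifT; last by lia.
by congr (_ * _ * ('C(_, _))%:R); lia.
Qed.

Lemma coef2_log2 i : (0 < i)%N ->
  (log2 N ('X : {poly {poly F}}) ('X * 'X%:P) ^+ i)`_n`_(s + l + 1)`_(s + 1) =
  if i == (s + l + 1)%N then (-1) ^+ (s + l + 1) * 'C(s + l + 1, s + 1)%:R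
    * 'C(n + s + l, 4 * s + 3 * l + 3)%:R else 0.
Proof.
move=> i_gt0; rewrite coef_log2 // coefXn_mulC.
case: eqP => [->|_]; last by rewrite coef0.
rewrite coef_poly ifT; last by lia.
by congr (_ * _ * ('C(_, _))%:R); lia.
Qed.

(** The total degree i + c = s + l + 1 leaves the single term c = s + l + 1 - i. *)
Lemma coef2_log3 i : (0 < i)%N ->
  (log3 N ('X : {poly {poly F}}) ('X * 'X%:P) ^+ i)`_n`_(s + l + 1)`_(s + 1) =
  if (i <= s + l + 1)%N then
    (-1) ^+ (s + 1) * ('C(i, s + l + 1 - i)%:R *
      \sum_(0 <= j < 2 * i - (s + l))
      (- 4%:R) ^+ j * 'C(2 * i - s - l - 1, j)%:R *
      'C(n + 2 * s + 2 * l + 1 - i + j, 4 * s + 4 * l + 3 - 2 * i + 2 * j)%:R *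
      (binz (2 * s + 2 * l + 2 - 2 * i) ((s + 1)%:Z - j%:Z))%:R)
  else 0.
Proof.
move=> i_gt0; rewrite coef_log3 // !coef_sum.
under eq_bigr do rewrite coefXn_mulC.
have [le_id|lt_di] := leqP i (s + l + 1); last first.
  by rewrite big1 // => c _; rewrite ifF ?coef0 //; lia.
(* If 2i < s + l + 1, that c would exceed i, and the binomial coefficient on the right is 0 as
   well. *)
have [lt_id|le_di] := ltnP (2 * i) (s + l + 1).
  rewrite big1 ?bin_small ?mul0r ?mulr0 //; first by lia.
  by move=> -[c /= lt_ci] _; rewrite ifF ?coef0 //; lia.
have lt_ci : (s + l + 1 - i < i.+1)%N by lia.
rewrite (bigD1 (Ordinal lt_ci)) //= subnKC // eqxx.
rewrite [X in _ + X]big1 ?addr0 => [|[c /= lt_c]]; last first.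
  rewrite -val_eqE /= => neq_c; rewrite ifF ?coef0 //.
  by apply/negP => /eqP e; case/eqP: neq_c; lia.
rewrite -polyC_natr coefCM mulrCA; congr (_ * _).
rewrite coef_sum mulr_sumr big_mkord.
have -> : (i - (s + l + 1 - i)).+1 = (2 * i - (s + l))%N by lia.
apply: eq_bigr => -[j /= lt_j] _.
have -> : (i - (s + l + 1 - i) = 2 * i - s - l - 1)%N by lia.
have -> :
  (n + (i + 2 * (s + l + 1 - i) + j) - 1 = n + 2 * s + 2 * l + 1 - i + j)%N.
  by lia.
have -> : (2 * (i + 2 * (s + l + 1 - i) + j) - 1 =
           4 * s + 4 * l + 3 - 2 * i + 2 * j)%N by lia.
have -> : (2 * (s + l + 1 - i) = 2 * s + 2 * l + 2 - 2 * i)%N by lia.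
rewrite -!polyC_natr -polyC_exp -!polyCM coefCM coefXnM coef_1subX_exp.
(* For j > s + 1 the power X^j kills the coefficient, and [binz] is 0 at a negative argument. *)
case: ltnP => [lt_sj|le_js].
  have -> : ((s + 1)%:Z - j%:Z)%R = Negz (j - (s + 1)).-1 by lia.
  by rewrite /= !mulr0.
rewrite subzn //=.
(* The extra sign (-1)^j turns 4^j into (-4)^j. *)
have -> : (-1) ^+ (s + 1) = (-1) ^+ (s + 1 - j) * (-1) ^+ j :> F.
  by rewrite -exprD subnK.
rewrite -[- 4%:R]mulN1r exprMn.
have : (-1) ^+ j * (-1) ^+ j = 1 :> F by rewrite -expr2 sqrr_sign.
move=> e; rewrite -[LHS]mul1r -[X in X * _]e; ring.
Qed.

End CoefGen.

(** The factor y in [gen34_log] shifts the coefficient (s + l, s) to (s + l + 1, s + 1), which is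
    then read on the right. The first two series contribute only at i = s + l + 1. *)
Lemma coef_gen34 (F : numClosedFieldType) n (z : F) l s :
  n.-primitive_root z ->
  n%:R ^+ 4 * (gen34 n z)`_(s + l)`_s =
  n%:R * ((-1) ^+ s / (s + 1)%:R * 'C(s + l, l)%:R *
    ('C(n + 3 * s + 2 * l + 2, 4 * s + 3 * l + 3)%:R
       + (-1) ^+ l * 'C(n + s + l, 4 * s + 3 * l + 3)%:R + A3 F n l s)).
Proof.
(* N must bound n for the truncation, and d so that the index i = d occurs in the sum. *)
move=> zP; set d := (s + l + 1)%N; set N := (n + d)%N.
have le_nN : (n <= N)%N by lia.
have := congr1 (fun p : {poly {poly F}} => p`_d`_(s + 1)) (gen34_log zP le_nN).
have natCM k (p : {poly {poly F}}) i j : (k%:R * p)`_i`_j = k%:R * p`_i`_j.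
  by rewrite !mulr_natl !coefMn.
rewrite -mulrA -natrX !natCM -mulrA {1}/d addn1 coefXM /= coefCM.
rewrite {1}addn1 coefXM /= natrX => ->; congr (_ * _).
rewrite !coef_sum.
under eq_big_nat => i /andP[i_gt0 _].
  rewrite !coefCM !coefB coef2_log1 // coef2_log2 // coef2_log3 //.
  rewrite !mulrBr; over.
rewrite !big_split /= !sumrN.
have d_gt0 : (0 < d <= N)%N by lia.
have only_d (g : F) :
    \sum_(1 <= i < N.+1) i%:R^-1 * (if i == d then g else 0) = d%:R^-1 * g.
  under eq_bigr do rewrite (fun_if ( *%R _)) mulr0.
  by rewrite -big_mkcond /= big_nat1_eq d_gt0.
rewrite !only_d {only_d}.
rewrite (@big_cat_nat _ _ _ d.+1) //=; last by lia.
rewrite [X in _ + X - _ - _]big_nat [X in _ + X - _ - _]big1 ?addr0; last first.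
  by move=> i /andP[lt_di _]; rewrite leqNgt lt_di mulr0.
have s1 : (s + 1)%:R != 0 :> F by rewrite addn1 pnatr_eq0.
have C0 : 'C(s + l, l)%:R != 0 :> F by rewrite pnatr_eq0 -lt0n bin_gt0 leq_addl.
have dE : d%:R != 0 :> F by rewrite /d addn1 pnatr_eq0.
(* Absorption identity; its factor d cancels the 1 / i at i = d. *)
have binE : 'C(d, s + 1)%:R = d%:R / (s + 1)%:R * 'C(s + l, l)%:R :> F.
  apply: (mulfI s1); rewrite mulrA mulrCA divff // mulr1 -!natrM.
  rewrite /d !addn1 -mul_bin_diag /=; congr (_ * _)%:R.
  by rewrite -bin_sub ?leq_addr // addKn.
rewrite binE mulrDr.
have -> : (-1) ^+ s / (s + 1)%:R * 'C(s + l, l)%:R * A3 F n l s =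
  \sum_(1 <= i < d.+1) i%:R^-1 * ((-1) ^+ (s + 1) * ('C(i, s + l + 1 - i)%:R *
      \sum_(0 <= j < 2 * i - (s + l))
      (- 4%:R) ^+ j * 'C(2 * i - s - l - 1, j)%:R *
      'C(n + 2 * s + 2 * l + 1 - i + j, 4 * s + 4 * l + 3 - 2 * i + 2 * j)%:R *
      (binz (2 * s + 2 * l + 2 - 2 * i) ((s + 1)%:Z - j%:Z))%:R)).
  rewrite /A3 mulr_sumr; apply: eq_big_nat => i /andP[i_gt0 _].
  move: (\sum_(0 <= j < _) _) => S.
  have i0 : i%:R != 0 :> F by rewrite pnatr_eq0 -lt0n.
  rewrite exprD expr1; move: ('C(s + l, l)%:R) (s + 1)%:R (i%:R) C0 s1 i0 => c
    t u.
  by move=> c0 t0 u0; field; rewrite c0 t0 u0.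
rewrite [RHS]addrC -addrA; congr (_ + _).
  apply: eq_big_nat => i /andP[_ lt_id]; by rewrite ltnS in lt_id;
    rewrite lt_id.
rewrite !exprD expr1; move: d%:R (s + 1)%:R dE s1 => u t u0 t0.
by field; rewrite u0 t0.
Qed.

(** * Words in the letters 3 and 4, and their generating function *)

Lemma big_tuple_cons (R : nmodType) (T : finType) k
    (P : pred (k.+1.-tuple T)) (G : k.+1.-tuple T -> R) :
  \sum_(t : k.+1.-tuple T | P t) G t =
  \sum_(x : T) \sum_(t : k.-tuple T | P [tuple of x :: t]) G [tuple of x :: t].
Proof.
rewrite pair_big_dep /=.
rewrite (reindex (fun p : T * k.-tuple T => [tuple of p.1 :: p.2])) //=.
exists (fun t => (thead t, [tuple of behead t])) => [[x t]|t] _ /=.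
  by rewrite theadE; congr (_, _); apply: val_inj.
by rewrite [RHS]tuple_eta.
Qed.

Lemma sum_tnth_cons N s (i : 'I_N) (t : s.-tuple 'I_N) :
  (\sum_(j < s.+1) tnth [tuple of i :: t] j = i + \sum_(j < s) tnth t j)%N.
Proof.
by rewrite big_ord_recl tnth0; congr addn; apply: eq_bigr => j _; rewrite tnthS.
Qed.

Section Words.
Variable R : comNzRingType.

Fixpoint iter_sum (g : nat -> nat -> R) (n : nat) (k : seq nat) : R :=
  if k is k1 :: k' then \sum_(1 <= m < n) g k1 m * iter_sum g m k' else 1.

(** The bound b is separate from N so that the induction can replace it by the first entry of the
    tuple while the type of the entries stays fixed. *)
Lemma iter_sum_tuple (g : nat -> nat -> R) N b (k : seq nat) : (b <= N)%N ->
  \sum_(m : (size k).-tuple 'I_N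
        | [&& sorted gtn [seq val x | x <- m], all (leq 1) [seq val x | x <- m]
            & all (gtn b) [seq val x | x <- m]])
     \prod_(i < size k) g (nth 0%N k i) (tnth m i) = iter_sum g b k.
Proof.
elim: k b => [|k1 k IH] b le_bN /=.
  rewrite (big_pred1 [tuple]) ?big_ord0 // => t.
  by rewrite tuple0 /= eqxx.
rewrite big_tuple_cons (big_nat_widen _ _ _ _ _ le_bN) big_geq_mkord.
rewrite [RHS]big_mkcond /=.
apply: eq_bigr => x _.
case: ifP => [/andP[lt_xb x_gt0]|x_out]; last first.
  rewrite big_pred0 // => t /=.
  apply/negP => /and3P[_ /andP[x_gt0 _] /andP[lt_xb _]].
  by rewrite lt_xb x_gt0 in x_out.
rewrite -(IH x) ?(ltnW (ltn_ord x)) // mulr_sumr.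
apply: eq_big => [t|t _] /=.
  rewrite path_sortedE; last by move=> i j h lt1 lt2; apply: ltn_trans lt2 lt1.
  rewrite lt_xb x_gt0 /=; set ks := [seq val y | y <- t].
  case allx: (all (gtn x) ks); last by rewrite !andbF.
  rewrite andbT; congr (_ && _); rewrite (_ : all (gtn b) ks) ?andbT //.
  by apply: sub_all allx => y /= lt_yx; apply: ltn_trans lt_xb.
rewrite big_ord_recl tnth0; congr (_ * _); apply: eq_bigr => i _.
by rewrite tnthS.
Qed.

(* Sum of [f] over the words with [s] letters 4 and [m] letters 3 that are empty
   or begin with 4. *)
Fixpoint blocks_sum (s m : nat) (f : seq nat -> R) : R :=
  if s is s'.+1 then
    \sum_(i < m.+1) blocks_sum s' (m - i) (fun w => f (4 :: nseq i 3 ++ w))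
  else if m == 0%N then f [::] else 0.

Definition words_sum (s l : nat) (f : seq nat -> R) : R :=
  \sum_(i < l.+1) blocks_sum s (l - i) (fun w => f (nseq i 3 ++ w)).

Lemma blocks_sum_tuple N s m (f : seq nat -> R) : (m < N)%N ->
  \sum_(d : s.-tuple 'I_N | (\sum_(i < s) tnth d i)%N == m)
     f (flatten [seq 4 :: nseq e 3 | e <- [seq val x | x <- d]]) =
  blocks_sum s m f.
Proof.
elim: s m f => [|s IH] m f lt_mN /=.
  case: eqP => [->|/eqP m0].
    by rewrite (big_pred1 [tuple]) // => t;
      rewrite tuple0 big_ord0 /= [RHS]eqxx.
  by rewrite big_pred0 // => t; rewrite big_ord0 eq_sym (negbTE m0).
rewrite big_tuple_cons (big_ord_widen_cond N predT
  (fun i => blocks_sum s (m - i) (fun w => f (4 :: nseq i 3 ++ w)))) //=.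
rewrite [RHS]big_mkcond; apply: eq_bigr => i _ /=.
case: ltnP => [le_im|lt_mi].
  rewrite -(IH (m - i)%N) ?(leq_ltn_trans (leq_subr _ _)) //.
  by apply: eq_bigl => t; rewrite sum_tnth_cons; apply/eqP/eqP; lia.
by rewrite big_pred0 // => t; rewrite sum_tnth_cons; apply/eqP; lia.
Qed.

Lemma words_sum_tuple s l (f : seq nat -> R) :
  \sum_(d : s.+1.-tuple 'I_l.+1 | (\sum_(i < s.+1) tnth d i)%N == l)
     f (index34 [seq val x | x <- d]) = words_sum s l f.
Proof.
rewrite big_tuple_cons; apply: eq_bigr => i _.
rewrite -(@blocks_sum_tuple l.+1) ?ltnS ?leq_subr //.
apply: eq_bigl => t; rewrite sum_tnth_cons.
have := ltn_ord i; move: (\sum_(_ < s) _)%N => S.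
by move=> lt_il; apply/eqP/eqP; lia.
Qed.

Lemma blocks_sum_linear s m (f g : seq nat -> R) c :
  blocks_sum s m (fun w => f w + c * g w) = blocks_sum s m f + c * blocks_sum s
    m g.
Proof.
elim: s m f g => [|s IH] m f g /=; first by case: eqP; rewrite // mulr0 addr0.
by rewrite mulr_sumr -big_split; apply: eq_bigr => i _; rewrite IH.
Qed.

Lemma eq_blocks_sum s m (f g : seq nat -> R) : f =1 g ->
  blocks_sum s m f = blocks_sum s m g.
Proof.
elim: s m f g => [|s IH] m f g fg /=; first by rewrite fg.
by apply: eq_bigr => i _; apply: IH => w; rewrite fg.
Qed.

Lemma words_sum_linear s l (f g h : seq nat -> R) c :
  (forall w, h w = f w + c * g w) ->
  words_sum s l h = words_sum s l f + c * words_sum s l g.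
Proof.
move=> hE; rewrite /words_sum mulr_sumr -big_split; apply: eq_bigr => i _.
by rewrite /= -blocks_sum_linear; apply: eq_blocks_sum => w; rewrite hE.
Qed.

Lemma words_sum0 s (f : seq nat -> R) : words_sum s 0 f = blocks_sum s 0 f.
Proof. by rewrite /words_sum big_ord_recl big_ord0 addr0. Qed.

(** Splits off the empty leading run of 3s; in the other words a first letter 3 can be removed.
    Together with [blocks_sumS] this is a recursion on the first letter. *)
Lemma words_sumS s l (f : seq nat -> R) :
  words_sum s l.+1 f = blocks_sum s l.+1 f + words_sum s l
    (fun w => f (3 :: w)).
Proof. by rewrite /words_sum big_ord_recl. Qed.

Lemma blocks_sumS s m (f : seq nat -> R) :
  blocks_sum s.+1 m f = words_sum s m (fun w => f (4 :: w)).
Proof. by []. Qed.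

Variables (al be : nat -> R).

Definition gen_words n : {poly {poly R}} :=
  \prod_(1 <= m < n) (1 + 'X * ((al m)%:P + (be m)%:P * 'X)%:P).

(** The new factor, for m = n, either contributes 1 or places one entry, a 3 with weight [al] or a 4
    with weight [be]. *)
Lemma coef_gen_wordsS n d e : (0 < n)%N ->
  (gen_words n.+1)`_d`_e = (gen_words n)`_d`_e +
    (if d is d'.+1 then al n * (gen_words n)`_d'`_e +
       (if e is e'.+1 then be n * (gen_words n)`_d'`_e' else 0) else 0).
Proof.
move=> n_gt0; rewrite /gen_words big_nat_recr //= mulrDr mulr1 coefD coefD.
congr (_ + _); rewrite mulrCA coefXM; case: d => [|d]; first by rewrite coef0.
rewrite /= coefMC -/(gen_words n); set p := (gen_words n)`_d.
have -> : p * ((al n)%:P + (be n)%:P * 'X) =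
          (al n)%:P * p + (be n)%:P * ('X * p) by ring.
by rewrite coefD !coefCM coefXM; case: e => [|e] //=; rewrite mulr0.
Qed.

Lemma coef_gen_words_gt n d e : (d < e)%N -> (gen_words n)`_d`_e = 0.
Proof.
elim: n d e => [|[|n] IH] d e lt_de.
- by rewrite /gen_words big_geq // coef1; case: d lt_de => [|d];
    rewrite ?coef0 // coef1; case: e.
- by rewrite /gen_words big_geq // coef1; case: d lt_de => [|d];
    rewrite ?coef0 // coef1; case: e.
rewrite coef_gen_wordsS // IH // add0r; case: d lt_de => // d.
case: e => // e lt_de; rewrite !IH ?mulr0 ?addr0 //; exact: ltnW.
Qed.

(** Both sides obey the same recurrence in n: when the bound grows by one, the new value is either
    not taken or is the largest index and carries the first letter. Each letter k brings the scaling
    u^k. *)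
Lemma words_sum_gen (g : nat -> nat -> R) (u : R) n s l :
  (forall m, g 3 m = u ^+ 3 * al m) -> (forall m, g 4 m = u ^+ 4 * be m) ->
  words_sum s l (iter_sum g n) = u ^+ (4 * s + 3 * l) *
    (gen_words n)`_(s + l)`_s.
Proof.
move=> g3 g4.
have iterS m k w : (0 < m)%N ->
    iter_sum g m.+1 (k :: w) = iter_sum g m (k :: w) + g k m * iter_sum g m w.
  by move=> m_gt0; rewrite /= big_nat_recr.
(* For a bound below 2 there is no index, so only the empty word contributes. *)
have base m s' l' : (m < 2)%N -> words_sum s' l' (iter_sum g m) =
    u ^+ (4 * s' + 3 * l') * (gen_words m)`_(s' + l')`_s'.
  move=> lt_m2; rewrite /gen_words big_geq //;
    have zero k w : iter_sum g m (k :: w) = 0.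
    by rewrite /= big_geq.
  have sum0 s2 l2 f : (forall w, f w = 0) -> words_sum s2 l2 f = 0.
    (* Linearity with c = 1 gives S = S + S. *)
    move=> f0; have /eqP : words_sum s2 l2 f = words_sum s2 l2 f + 1 *
      words_sum s2 l2 f.
      by apply: words_sum_linear => w; rewrite f0 mulr0 addr0.
    by rewrite mul1r -[X in X == _]addr0 (inj_eq (addrI _)) eq_sym => /eqP.
  case: s' l' => [|s'] [|l'].
  - by rewrite words_sum0 /= coef1 /= coef1 mulr1.
  - rewrite words_sumS /= add0r sum0 => [|w]; last exact: zero.
    by rewrite coef1 /= coef0 mulr0.
  - rewrite words_sum0 blocks_sumS sum0 => [|w]; last exact: zero.
    by rewrite coef1 /= coef0 mulr0.
  rewrite words_sumS blocks_sumS !sum0 => [|w|w]; try exact: zero.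
  by rewrite coef1 /= coef0 mulr0 addr0.
elim: n s l => [|[|n] IH] s l; [exact: base | exact: base |].
case: s l => [|s] [|l].
- by rewrite coef_gen_wordsS // addr0 -IH !words_sum0.
- rewrite words_sumS /= add0r
    (words_sum_linear _ _ (fun w => iterS _ 3 w (ltn0Sn n))).
  rewrite add0n coef_gen_wordsS //= addr0 mulrDr.
  have := IH 0%N l.+1; rewrite words_sumS /= add0r => ->; congr (_ + _).
  rewrite IH g3 mulnS !exprD add0n; ring.
- rewrite words_sum0 blocks_sumS.
  rewrite (words_sum_linear _ _ (fun w => iterS _ 4 w (ltn0Sn n))).
  rewrite -blocks_sumS -words_sum0 !IH !addn0.
  (* With no letter 3 left, the [al] term involves the coefficient (s, s + 1), which is 0. *)
  rewrite (coef_gen_wordsS s.+1 s.+1 (ltn0Sn n))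
    (coef_gen_words_gt _ (ltnSn s)) g4 mulnS !exprD; ring.
rewrite words_sumS blocks_sumS.
rewrite (words_sum_linear _ _ (fun w => iterS _ 4 w (ltn0Sn n))).
rewrite (words_sum_linear _ _ (fun w => iterS _ 3 w (ltn0Sn n))).
rewrite addrACA -blocks_sumS -words_sumS !IH [(s.+1 + l.+1)%N]addSn.
rewrite (coef_gen_wordsS _ s.+1 (ltn0Sn n)) [(s.+1 + l)%N]addSnnS g3 g4 !mulnS
  !exprD; ring.
Qed.

End Words.

(** * Conclusion for the sums over indices *)

Lemma mhqs_iter_sum (F : fieldType) n (k : seq nat) (q : F) :
  mhqs n k q =
  iter_sum (fun k1 m => q ^+ (k1.-1 * m) / qint q m ^+ k1) n k.
Proof.
rewrite -(iter_sum_tuple _ _ (leqnn n)) /mhqs; apply: eq_bigl => m.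
have -> : all (gtn n) [seq val x | x <- m].
  by apply/allP => _ /mapP[x _ ->] /=.
by rewrite andbT.
Qed.

(** Each entry k contributes z^((k-1)m) / [m]^k = (1 - z)^k z^((k-1)m) / (1 - z^m)^k, so
    [words_sum_gen] applies with u = 1 - z. *)
Lemma W3_gen34 (F : fieldType) n l s (z : F) :
  W3 n l s z = (1 - z) ^+ (4 * s + 3 * l) * (gen34 n z)`_(s + l)`_s.
Proof.
rewrite -(@words_sum_gen _ _ _
  (fun k1 m => z ^+ (k1.-1 * m) / qint z m ^+ k1)) => [|m|m]; first last.
- by rewrite /qint expr_div_n invf_div mulrCA /= mulnC exprM.
- by rewrite /qint expr_div_n invf_div mulrCA /= mulnC exprM.
rewrite -words_sum_tuple; apply: eq_bigr => d _; exact: mhqs_iter_sum.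
Qed.

Unset Implicit Arguments.

Theorem theorem1p3 (R : realType) (n : nat) (zeta : complex R)
    (hn : (0 < n)%N) (hzeta : n.-primitive_root zeta) :
  forall l s : nat,
    W3 n l s zeta =
      (-1) ^+ s / (n%:R ^+ 3 * (s + 1)%:R) * 'C(s + l, l)%:R *
      ('C(n + 3 * s + 2 * l + 2, 4 * s + 3 * l + 3)%:R
       + (-1) ^+ l * 'C(n + s + l, 4 * s + 3 * l + 3)%:R
       + A3 (complex R) n l s)
      * (1 - zeta) ^+ (4 * s + 3 * l).
Proof.
move=> l s; rewrite W3_gen34 mulrC; congr (_ * _).
have n0 : n%:R != 0 :> complex R by rewrite pnatr_eq0 -lt0n.
(* The n^4 on the left of [coef_gen34] against the n on its right leaves the n^3 of the
   denominator. *)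
apply: (mulfI (expf_neq0 4 n0)); rewrite coef_gen34 //.
have s1 : (s + 1)%:R != 0 :> complex R by rewrite addn1 pnatr_eq0.
move: (_ + A3 _ _ _ _) => B.
move: (s + 1)%:R n%:R s1 n0 => t u t0 u0.
by field; rewrite t0 u0.
Qed.
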